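(* Let $\mathcal{A}$ and $\mathcal{B}$ be Banach algebras. Then the following statements hold: (i) Suppose $\mathcal{A}$ is commutative and $\overline{\mathcal{A}^{2}}=\mathcal{A}$. If $\mathcal{A}$ and $\mathcal{B}$ are approximately cyclic amenable, then $\mathcal{A}\oplus\mathcal{B}$ is approximately cyclic amenable. (ii) If $\mathcal{A}\oplus\mathcal{B}$ is approximately cyclic amenable, then both $\mathcal{A}$ and $\mathcal{B}$ are approximately cyclic amenable.
   Context: Banach algebras are over $\mathbb{C}$ and need not be unital. For a Banach algebra $\mathcal{A}$, the dual $\mathcal{A}^{*}$ is a Banach $\mathcal{A}$-bimodule via $\langle a\cdot x^{*},x\rangle=\langle x^{*},xa\rangle$ and $\langle x^{*}\cdot a,x\rangle=\langle x^{*},ax\rangle$ for $a,x\in\mathcal{A}$, $x^*\in\mathcal{A}^*$. A derivation $D:\mathcal{A}\to\mathcal{A}^{*}$ is a bounded linear map with $D(ab)=D(a)\cdot b+a\cdot D(b)$ for all $a,b\in\mathcal{A}$. It is cyclic if $\langle D(a),b\rangle+\langle D(b),a\rangle=0$ for all $a,b\in\mathcal{A}$. It is approximately inner if there is a net $(x_\alpha)\subseteq\mathcal{A}^{*}$ (not required to be bounded) with $D(a)=\lim_\alpha(a\cdot x_\alpha-x_\alpha\cdot a)$ in norm for every $a\in\mathcal{A}$. $\mathcal{A}$ is approximately cyclic amenable if every cyclic derivation $D:\mathcal{A}\to\mathcal{A}^{*}$ is approximately inner. $\mathcal{A}^{2}$ denotes the linear span of $\{ab: a,b\in\mathcal{A}\}$,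 and the bar denotes norm closure. $\mathcal{A}\oplus\mathcal{B}$ is the direct sum with coordinatewise product and the $\ell^{1}$-norm $\|(a,b)\|=\|a\|+\|b\|$. *)

(* Defs.v *)
From HB Require Import structures.
From mathcomp Require Import all_boot all_order all_algebra.
From mathcomp Require Import all_classical all_reals all_analysis.
From mathcomp Require Import complex.

Set Implicit Arguments.
Unset Strict Implicit.
Unset Printing Implicit Defensive.

Import Order.TTheory GRing.Theory Num.Theory.
Import numFieldNormedType.Exports.

Local Open Scope classical_set_scope.
Local Open Scope ring_scope.
Local Open Scope complex_scope.

(* The library's rings are unital, so the product of a (not necessarily unital)
   Banach algebra is a separate operation, written [x ** y]. *)
HB.mixin Record CompleteNormedModule_isBanachAlgebra (R : realType) A
    of CompleteNormedModule R[i] A := {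
  bmul : A -> A -> A ;
  bmulA : associative bmul ;
  bmulDl : left_distributive bmul +%R ;
  bmulDr : right_distributive bmul +%R ;
  bmulZl : forall (k : R[i]) (x y : A), bmul (k *: x) y = k *: bmul x y ;
  bmulZr : forall (k : R[i]) (x y : A), bmul x (k *: y) = k *: bmul x y ;
  ler_normbM : forall x y : A, `|bmul x y| <= `|x| * `|y|
}.

#[short(type="banachAlgType")]
HB.structure Definition BanachAlgebra (R : realType) :=
  {A of CompleteNormedModule R[i] A
   & CompleteNormedModule_isBanachAlgebra R A}.

Notation "x ** y" := (bmul x y) (at level 40, left associativity) : ring_scope.

Definition bounded_linear (R : realType) (V W : normedModType R[i])
    (f : V -> W) : Prop :=
  linear f /\ exists M : R[i], forall x : V, `|f x| <= M * `|x|.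

Section Dual.
Variables (R : realType) (V : normedModType R[i]).
Local Notation C := (R[i]).

Definition bounded_functional : {pred V -> C^o} :=
  fun f => `[< bounded_linear (f : V -> C^o) >].

Record dual := Dual {
  dual_val :> V -> C^o ;
  _ : dual_val \in bounded_functional
}.

HB.instance Definition _ := [isSub for dual_val].
HB.instance Definition _ := [Choice of dual by <:].

Lemma functionalP (f : V -> C^o) :
  (f \in bounded_functional) <-> bounded_linear f.
Proof. by split => [/asboolP|?]; [|apply/asboolP]. Qed.

Lemma functional_submod_closed : submod_closed bounded_functional.
Proof.
split=> [|k f g /functionalP[lf [M fM]] /functionalP[lg [N gN]]];
  apply/functionalP; split.
- by move=> a x y /=; rewrite scaler0 addr0.
- by exists 0 => x; rewrite normr0 mul0r.
- move=> a x y; rewrite !fctE lf lg !scalerDr !scalerA (mulrC k a).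
  by rewrite addrACA.
- exists (`|k| * M + N) => x; rewrite !fctE mulrDl -mulrA.
  rewrite (le_trans (ler_normD _ _))// lerD// normrM.
  exact: ler_wpM2l.
Qed.

HB.instance Definition _ :=
  GRing.isSubmodClosed.Build C (V -> C^o) bounded_functional
    functional_submod_closed.
HB.instance Definition _ := [SubChoice_isSubLmodule of dual by <:].

Lemma dual_bounded_linear (f : dual) : bounded_linear (f : V -> C^o).
Proof. by apply/functionalP; case: f. Qed.

Lemma dual_linear (f : dual) : linear (f : V -> C^o).
Proof. exact: (dual_bounded_linear f).1. Qed.

Lemma dual0 (f : dual) : f 0 = 0 :> C^o.
Proof.
have /eqP := dual_linear f 1 0 0.
by rewrite !scale1r addr0 eq_sym -subr_eq0 addrK => /eqP.
Qed.

Lemma dualZ (f : dual) (k : C) x : f (k *: x) = k * f x :> C.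
Proof. by have := dual_linear f k x 0; rewrite addr0 dual0 addr0. Qed.

End Dual.

Section DualNorm.
Variables (R : realType) (V : normedModType R[i]).
Local Notation C := (R[i]).
Implicit Types f g : dual V.

(* The norm of a normed module over [R[i]] takes its (real) values in [R[i]];
   the supremum is taken in [R] and injected back by [%:C]. *)
Definition opnorm f : R :=
  sup [set complex.Re `|f x : C| | x in [set x : V | `|x| <= 1]].

Lemma norm_Re (W : normedModType C) (w : W) : `|w| = (complex.Re `|w|)%:C.
Proof. by rewrite RRe_real// ger0_real. Qed.

Lemma dual_boundedP f :
  exists2 M : R, 0 <= M & forall x : V, `|f x : C| <= M%:C * `|x|.
Proof.
have [_ [M fM]] := dual_bounded_linear f.
exists (complex.Re `|M : C^o|); first by rewrite -ler0c -norm_Re.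
move=> x; rewrite -norm_Re (le_trans (fM x))//.
have Mx0 : 0 <= M * `|x| by apply: le_trans (fM x).
by rewrite -{1}(ger0_norm Mx0) normrM normr_id.
Qed.

Lemma opnorm_has_sup f :
  has_sup [set complex.Re `|f x : C| | x in [set x : V | `|x| <= 1]].
Proof.
split; first by exists (complex.Re `|f 0 : C|), 0 => //=; rewrite normr0 ler01.
have [M M0 fM] := dual_boundedP f.
exists M => _ [x /= x1 <-]; rewrite -lecR -(norm_Re (f x : C^o)).
by rewrite (le_trans (fM x))// ler_piMr// ler0c.
Qed.

Lemma opnorm_ubound f (x : V) : `|f x : C| <= (opnorm f)%:C * `|x|.
Proof.
have [->|x0] := eqVneq x 0.
  by rewrite dual0 !normr0 mulr0.
have nx0 : 0 < `|x| by rewrite normr_gt0.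
pose y := `|x|^-1 *: x.
have y1 : `|y| = 1.
  by rewrite normrZ normfV normr_id mulVf// gt_eqF.
have -> : x = `|x| *: y by rewrite scalerA mulfV ?scale1r// gt_eqF.
rewrite dualZ normrM normr_id normrZ y1 mulr1 normr_id mulrC.
rewrite ler_pM2r// (norm_Re (f y : C^o)) lecR.
by apply: (sup_upper_bound (opnorm_has_sup f)); exists y => //=; rewrite y1.
Qed.

Lemma opnorm_le f (M : R) : 0 <= M ->
  (forall x : V, `|f x : C| <= M%:C * `|x|) -> opnorm f <= M.
Proof.
move=> M0 fM; apply: ge_sup; first by case: (opnorm_has_sup f).
move=> _ [x /= x1 <-]; rewrite -lecR -(norm_Re (f x : C^o)).
by rewrite (le_trans (fM x))// ler_piMr// ler0c.
Qed.

Lemma opnorm_ge0 f : 0 <= opnorm f.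
Proof.
apply: (sup_upper_bound (opnorm_has_sup f)); exists 0.
  by rewrite /= normr0 ler01.
by rewrite dual0 normr0.
Qed.

Lemma opnormD f g : (opnorm (f + g))%:C <= (opnorm f)%:C + (opnorm g)%:C.
Proof.
rewrite -rmorphD lecR opnorm_le ?addr_ge0 ?opnorm_ge0// => x.
rewrite rmorphD mulrDl (le_trans (ler_normD _ _))//.
by apply: lerD; exact: opnorm_ubound.
Qed.

Lemma opnormZ_le (k : C) f : (opnorm (k *: f))%:C <= `|k| * (opnorm f)%:C.
Proof.
rewrite (norm_Re (k : C^o)) -rmorphM lecR.
have k0 : 0 <= complex.Re `|k : C^o| by rewrite -ler0c -norm_Re.
rewrite opnorm_le ?mulr_ge0 ?opnorm_ge0// => x.
have /esym kE := norm_Re (k : C^o).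
rewrite rmorphM [X in X * _ * _]kE -mulrA normrM.
by apply: ler_wpM2l => //; exact: opnorm_ubound.
Qed.

Lemma opnormZ (k : C) f : (opnorm (k *: f))%:C = `|k| * (opnorm f)%:C.
Proof.
apply/eqP; rewrite eq_le opnormZ_le/=.
have [->|k0] := eqVneq k 0.
  by rewrite normr0 mul0r ler0c opnorm_ge0.
rewrite -ler_pdivlMl ?normr_gt0// -normfV.
by rewrite (le_trans _ (opnormZ_le _ _))// scalerA mulVf// scale1r.
Qed.

Lemma opnorm0_eq0 f : (opnorm f)%:C = 0 -> f = 0.
Proof.
move=> f0; apply/val_inj/funext => x /=; apply/eqP; rewrite -normr_le0.
by have := opnorm_ubound f x; rewrite f0 mul0r.
Qed.

HB.instance Definition _ :=
  Lmodule_isNormed.Build C (dual V) opnormD opnormZ opnorm0_eq0.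

Lemma dual_normE f : `|f| = (opnorm f)%:C.
Proof. by []. Qed.

End DualNorm.

Section Bimodule.
Variables (R : realType) (A : banachAlgType R).
Local Notation C := (R[i]).

Lemma dual_lact_subproof (a : A) (f : dual A) :
  ((fun x => f (x ** a)) : A -> C^o) \in @bounded_functional R A.
Proof.
apply/functionalP; split.
  by move=> k x y; rewrite bmulDl bmulZl dual_linear.
exists (`|f| * `|a|) => x; rewrite (le_trans (opnorm_ubound _ _))// -mulrA.
by rewrite ler_wpM2l ?ler0c ?opnorm_ge0// (mulrC `|a|) ler_normbM.
Qed.

Lemma dual_ract_subproof (f : dual A) (a : A) :
  ((fun x => f (a ** x)) : A -> C^o) \in @bounded_functional R A.
Proof.
apply/functionalP; split.
  by move=> k x y; rewrite bmulDr bmulZr dual_linear.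
exists (`|f| * `|a|) => x; rewrite (le_trans (opnorm_ubound _ _))// -mulrA.
by rewrite ler_wpM2l ?ler0c ?opnorm_ge0// ler_normbM.
Qed.

Definition dual_lact (a : A) (f : dual A) : dual A :=
  Dual (dual_lact_subproof a f).

Definition dual_ract (f : dual A) (a : A) : dual A :=
  Dual (dual_ract_subproof f a).

Definition derivation (D : A -> dual A) : Prop :=
  bounded_linear D /\
  forall a b : A, D (a ** b) = dual_ract (D a) b + dual_lact a (D b).

Definition cyclic (D : A -> dual A) : Prop :=
  forall a b : A, D a b + D b a = 0.

End Bimodule.

Definition directed (I : Type) (le : I -> I -> Prop) : Prop :=
  [/\ inhabited I,
      forall i, le i i,
      forall i j k, le i j -> le j k -> le i k
    & forall i j, exists k, le i k /\ le j k].

Definition net_tails (I : Type) (le : I -> I -> Prop) : set_system I :=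
  [set S | exists i0, forall i, le i0 i -> S i].

Definition approximately_inner (R : realType) (A : banachAlgType R)
    (D : A -> dual A) : Prop :=
  exists (I : Type) (le : I -> I -> Prop) (x : I -> dual A),
    directed le /\
    forall a : A,
      dual_lact a (x i) - dual_ract (x i) a @[i --> net_tails le] --> D a.

Definition approximately_cyclic_amenable (R : realType) (A : banachAlgType R) :
    Prop :=
  forall D : A -> dual A, derivation D -> cyclic D -> approximately_inner D.

Definition commutative_algebra (R : realType) (A : banachAlgType R) : Prop :=
  commutative (@bmul R A).

Definition algebra_square (R : realType) (A : banachAlgType R) : set A :=
  [set x | exists (n : nat) (c : 'I_n -> R[i]) (a b : 'I_n -> A),
     x = \sum_(i < n) c i *: (a i ** b i)].
Arguments algebra_square {R} A.

(* A copy of the product type, needed because the library's norm on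
   [A * B] is the maximum of the norms of the components. *)
Definition l1sum (R : realType) (A B : banachAlgType R) : Type := (A * B)%type.

Section L1Sum.
Variables (R : realType) (A B : banachAlgType R).
Local Notation C := (R[i]).
Local Notation S := (l1sum A B).

HB.instance Definition _ := GRing.Lmodule.copy S (A * B)%type.

Definition l1norm (p : S) : C := `|p.1| + `|p.2|.

Lemma l1normD (p q : S) : l1norm (p + q) <= l1norm p + l1norm q.
Proof. by rewrite /l1norm addrACA lerD// ler_normD. Qed.

Lemma l1normZ (k : C) (p : S) : l1norm (k *: p) = `|k| * l1norm p.
Proof. by rewrite /l1norm !normrZ mulrDr. Qed.

Lemma l1norm_eq0 (p : S) : l1norm p = 0 -> p = 0.
Proof.
case: p => a b /eqP; rewrite /l1norm paddr_eq0//= !normr_eq0.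
by move=> /andP[/eqP-> /eqP->].
Qed.

HB.instance Definition _ :=
  Lmodule_isNormed.Build C S l1normD l1normZ l1norm_eq0.

Lemma l1sum_complete (F : set_system S) : ProperFilter F -> cauchy F -> cvg F.
Proof.
move=> FF /cauchy_ballP Fc.
have c1 : cauchy (fst @ F : set_system A).
  apply/cauchy_ballP => e e0; have [[P Q] /= [FP FQ] PQ] := Fc e e0.
  exists (fst @` P, fst @` Q) => /=.
    by split; [apply: filterS FP|apply: filterS FQ] => p; exists p.
  move=> [_ _] /= [[p Pp <-] [q Qq <-]]; move: (PQ (p, q) (conj Pp Qq)).
  by rewrite /= -!ball_normE /=; apply: le_lt_trans;
    rewrite -[leRHS]/(l1norm _) lerDl.
have c2 : cauchy (snd @ F : set_system B).
  apply/cauchy_ballP => e e0; have [[P Q] /= [FP FQ] PQ] := Fc e e0.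
  exists (snd @` P, snd @` Q) => /=.
    by split; [apply: filterS FP|apply: filterS FQ] => p; exists p.
  move=> [_ _] /= [[p Pp <-] [q Qq <-]]; move: (PQ (p, q) (conj Pp Qq)).
  by rewrite /= -!ball_normE /=; apply: le_lt_trans;
    rewrite -[leRHS]/(l1norm _) lerDr.
have /cvg_ex[a Fa] : cvg (fst @ F : set_system A) by exact: cauchy_cvg.
have /cvg_ex[b Fb] : cvg (snd @ F : set_system B) by exact: cauchy_cvg.
apply/cvg_ex; exists ((a, b) : S); apply/fcvgrPdist_lt => e e0.
have e20 : 0 < e / 2 by rewrite divr_gt0.
have /cvgrPdist_lt/(_ _ e20) Fae := Fa.
have /cvgrPdist_lt/(_ _ e20) Fbe := Fb.
near=> p; rewrite (splitr e) -[ltLHS]/(l1norm _) ltrD//.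
  by near: p; exact: Fae.
by near: p; exact: Fbe.
Unshelve. all: by end_near. Qed.

HB.instance Definition _ := Uniform_isComplete.Build S l1sum_complete.

Definition l1mul (p q : S) : S := (p.1 ** q.1, p.2 ** q.2).

Lemma l1mulA : associative l1mul.
Proof. by move=> p q r; rewrite /l1mul/= !bmulA. Qed.

Lemma l1mulDl : left_distributive l1mul +%R.
Proof. by move=> p q r; rewrite /l1mul/= !bmulDl. Qed.

Lemma l1mulDr : right_distributive l1mul +%R.
Proof. by move=> p q r; rewrite /l1mul/= !bmulDr. Qed.

Lemma l1mulZl (k : C) (p q : S) : l1mul (k *: p) q = k *: l1mul p q.
Proof. by rewrite /l1mul/= !bmulZl. Qed.

Lemma l1mulZr (k : C) (p q : S) : l1mul p (k *: q) = k *: l1mul p q.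
Proof. by rewrite /l1mul/= !bmulZr. Qed.

Lemma l1normM (p q : S) : `|l1mul p q| <= `|p| * `|q|.
Proof.
apply: (le_trans (lerD (ler_normbM _ _) (ler_normbM _ _))).
rewrite [leRHS]mulrDl !mulrDr.
by apply: lerD; rewrite ?lerDl ?lerDr mulr_ge0.
Qed.

HB.instance Definition _ := CompleteNormedModule_isBanachAlgebra.Build R S
  l1mulA l1mulDl l1mulDr l1mulZl l1mulZr l1normM.

End L1Sum.

(* Main.v *)
Require Import Defs.
From mathcomp Require Import all_boot all_order all_algebra.
From mathcomp Require Import all_classical all_reals all_analysis.
From mathcomp Require Import complex.

(** Cyclic derivations travel along bounded algebra homomorphisms: if
    [h : A -> S] is one and [D] is a derivation on [S], then [h^* D h], that is
    [a |-> D (h a) \o h], is a derivation on [A]; it is cyclic when [D] is, and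
    approximately inner when [D] is, because [h^*] is norm continuous and
    carries the inner derivation of [x] to the inner derivation of [h^* x].

    This gives at once that approximate cyclic amenability passes to a retract
    [A] of [S], with homomorphisms [i : A -> S] and [p : S -> A] such that
    [p (i a) = a]: a cyclic derivation [D] on [A] equals [i^* (p^* D p) i], and
    [p^* D p] is approximately inner.  Each summand of [l1sum A B] is a
    retract of it, which is part (ii).

    For part (i), a cyclic derivation [D] on [l1sum A B] is the sum of four
    blocks.  The block [A -> A^*] is a cyclic derivation of [A]; it is
    approximately inner, hence zero because inner derivations of a commutative
    algebra vanish.  The functional on [A] which [D] assigns to an element of
    [B] vanishes on products of elements of [A]: cyclicity moves the product
    into the argument of [D], and each term of the derivation rule then involves
    a product crossing the two summands, which is zero.  By density of the span
    of the products, the block [B -> A^*] is zero, and so is [A -> B^*] by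
    cyclicity.  Only the block [B -> B^*] is left: [D] is the pullback along
    the projection onto [B] of an approximately inner derivation. *)

Set Implicit Arguments.
Unset Strict Implicit.
Unset Printing Implicit Defensive.

Import Order.TTheory GRing.Theory Num.Theory.
Import numFieldNormedType.Exports.

Local Open Scope classical_set_scope.

(** * Bounded linear maps and pullbacks of functionals *)

Section BoundedLinear.
Local Open Scope ring_scope.
Local Open Scope complex_scope.
Context {R : realType}.
Implicit Types U V W : normedModType R[i].

Lemma bounded_linear_ge0 V W (f : V -> W) : bounded_linear f ->
  exists2 M : R[i], 0 <= M & forall x, `|f x| <= M * `|x|.
Proof.
move=> [_ [M fM]]; exists `|M| => // x.
have Mx0 : 0 <= M * `|x| by apply: le_trans (fM x).
by rewrite (le_trans (fM x))// -(ger0_norm Mx0) normrM normr_id.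
Qed.

Lemma bounded_linearB V W (f : V -> W) : bounded_linear f ->
  {morph f : x y / x - y}.
Proof.
move=> [lf _] x y; rewrite -(scaleN1r y) addrC lf.
by rewrite scaleN1r addrC.
Qed.

Lemma bounded_linearD V W (f : V -> W) : bounded_linear f ->
  {morph f : x y / x + y}.
Proof. by move=> [lf _] x y; have := lf 1 x y; rewrite !scale1r. Qed.

Lemma bounded_linear_continuous V W (f : V -> W) : bounded_linear f ->
  continuous f.
Proof.
move=> bf x; have [M M0 fM] := bounded_linear_ge0 bf.
have M1 : 0 < M + 1 by rewrite ltr_wpDl.
apply/cvgrPdist_lt => e e0.
have /cvgrPdist_lt/(_ (e / (M + 1))) : y @[y --> x] --> x by exact: cvg_id.
rewrite divr_gt0// => /(_ isT); apply: filterS => y.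
rewrite ltr_pdivlMr// mulrC -bounded_linearB// => xy.
rewrite (le_lt_trans (fM _))// (le_lt_trans _ xy)//.
by rewrite ler_wpM2r// lerDl.
Qed.

Lemma bounded_linear_comp U V W (f : V -> W) (g : U -> V) :
  bounded_linear f -> bounded_linear g -> bounded_linear (f \o g).
Proof.
move=> bf bg; split=> [k x y /=|]; first by rewrite bg.1 bf.1.
have [M M0 fM] := bounded_linear_ge0 bf; have [N N0 gN] := bounded_linear_ge0 bg.
exists (M * N) => x; rewrite (le_trans (fM _))// -mulrA.
by rewrite ler_wpM2l.
Qed.

Section Pullback.
Context V W (h : V -> W) (bh : bounded_linear h).

Lemma pullback_subproof (f : dual W) :
  ((f : W -> R[i]^o) \o h) \in @bounded_functional R V.
Proof.
apply/functionalP; apply: bounded_linear_comp => //.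
exact: dual_bounded_linear.
Qed.

Definition pullback (f : dual W) : dual V := Dual (pullback_subproof f).

Lemma pullback_bounded_linear : bounded_linear pullback.
Proof.
split=> [k f g|]; first exact/val_inj/funext.
have [M M0 hM] := bounded_linear_ge0 bh.
exists M => f.
have /complex_realP[N MN] : M \is Num.real by exact: ger0_real.
rewrite !dual_normE MN -rmorphM lecR; rewrite MN ler0c in M0.
rewrite opnorm_le ?mulr_ge0 ?opnorm_ge0// => x.
rewrite (le_trans (opnorm_ubound f _))// rmorphM/= -MN (mulrC M) -mulrA.
by rewrite ler_wpM2l// ler0c opnorm_ge0.
Qed.

End Pullback.
End BoundedLinear.

(** * Derivations transported along a bounded homomorphism *)

Section Transport.
Local Open Scope ring_scope.
Context {R : realType} {A S : banachAlgType R}.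

Definition bounded_hom (h : A -> S) : Prop :=
  bounded_linear h /\ {morph h : x y / x ** y}.

Context {h : A -> S} (hh : bounded_hom h).

(** The derivation [h^* D h]. *)
Definition transport (D : S -> dual S) (a : A) : dual A :=
  pullback hh.1 (D (h a)).

Lemma transport_derivation D : derivation D -> derivation (transport D).
Proof.
move=> [bD dD]; split.
  apply: (bounded_linear_comp (pullback_bounded_linear hh.1)).
  exact: (bounded_linear_comp bD hh.1).
move=> a b; apply/val_inj/funext => x.
by rewrite /= hh.2 dD /= !fctE /= !hh.2.
Qed.

Lemma transport_cyclic D : cyclic D -> cyclic (transport D).
Proof. by move=> cD a b; exact: cD. Qed.

(** As [h] is multiplicative, [h^*] is a bimodule map over it. This is what makes
    approximating nets pull back to approximating nets. *)
Lemma pullback_inner (x : dual S) (a : A) :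
  pullback hh.1 (dual_lact (h a) x - dual_ract x (h a)) =
  dual_lact a (pullback hh.1 x) - dual_ract (pullback hh.1 x) a.
Proof. by apply/val_inj/funext => c; rewrite /= !fctE /= !hh.2. Qed.

Lemma transport_approximately_inner D :
  approximately_inner D -> approximately_inner (transport D).
Proof.
move=> [I [le [x [dle xD]]]].
exists I, le, (fun i => pullback hh.1 (x i)); split=> // a.
under eq_fun do rewrite -pullback_inner.
have hc : continuous (pullback hh.1).
  exact: bounded_linear_continuous (pullback_bounded_linear hh.1).
exact: (cvg_comp _ _ (xD (h a)) (hc _)).
Qed.

End Transport.

(** * Retracts, commutative algebras and dense squares *)

Section ApproximateCyclicAmenability.
Local Open Scope ring_scope.
Context {R : realType}.

(** Since [p (i a) = a], a derivation on [A] is recovered from its extension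
    [p^* D p] to [S] by restricting the latter along [i]. *)
Lemma approximately_cyclic_amenable_retract (A S : banachAlgType R)
    (i : A -> S) (p : S -> A) : bounded_hom i -> bounded_hom p ->
  cancel i p ->
  approximately_cyclic_amenable S -> approximately_cyclic_amenable A.
Proof.
move=> hi hp ipK aS D dD cD.
have -> : D = transport hi (transport hp D).
  by apply/funext => a; apply/val_inj/funext => c; rewrite /= !ipK.
apply: transport_approximately_inner; apply: aS.
- exact: transport_derivation.
- exact: transport_cyclic.
Qed.

Lemma net_tails_proper (I : Type) (le : I -> I -> Prop) :
  directed le -> ProperFilter (net_tails le).
Proof.
move=> [[i0] refl tr dir]; split.
  by move=> [i /(_ i (refl i))].
split.
- by exists i0.
- move=> P Q [i Pi] [j Qj]; have [k [ik jk]] := dir i j.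
  by exists k => l kl; split; [apply/Pi/(tr _ _ _ ik)|apply/Qj/(tr _ _ _ jk)].
- by move=> P Q PQ [i Pi]; exists i => j /Pi/PQ.
Qed.

(** The approximating net consists of inner derivations, which are zero on a
    commutative algebra; limits are unique. *)
Lemma commutative_approximately_inner_eq0 (A : banachAlgType R)
    (D : A -> dual A) (a : A) :
  commutative_algebra A -> approximately_inner D -> D a = 0.
Proof.
move=> cA [I [le [x [dle /(_ a) xD]]]].
have PF := net_tails_proper dle.
apply: (cvg_unique (@norm_hausdorff _ _) xD).
rewrite (_ : (fun i => _) = cst 0); first exact: cvg_cst.
apply/funext => i; apply/val_inj/funext => c.
by rewrite /= !fctE /= cA subrr.
Qed.

Lemma functional_eq0_square (A : banachAlgType R) (f : dual A) :
  closure (@algebra_square R A) = [set: A] ->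
  (forall a b : A, f (a ** b) = 0) -> f = 0.
Proof.
move=> dA f0; apply/val_inj/funext => x /=.
have bf := dual_bounded_linear f.
have cf : closed (f @^-1` [set 0 : R[i]^o]).
  apply: closed_comp => [y _|]; first exact: bounded_linear_continuous.
  exact/accessible_closed_set1/hausdorff_accessible/norm_hausdorff.
have sf : @algebra_square R A `<=` f @^-1` [set 0].
  move=> _ [n [c [a [b ->]]]] /=.
  elim/big_ind: _ => [|u v fu fv|i _]; first exact: dual0.
    by rewrite bounded_linearD// fu fv addr0.
  by rewrite dualZ f0 mulr0.
have : closure (@algebra_square R A) x by rewrite dA.
by move/(closure_subset sf); rewrite -(closure_id _).1.
Qed.

End ApproximateCyclicAmenability.

(** * The direct sum *)

Section DirectSum.
Local Open Scope ring_scope.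
Context {R : realType} {A B : banachAlgType R}.
Local Notation S := (l1sum A B).

(** The copy [l1sum A B] carries its own norm and product, so the injections and
    projections are named with that type in order to be seen as maps between
    Banach algebras. *)
Definition l1inl (a : A) : S := (a, 0).
Definition l1inr (b : B) : S := (0, b).
Definition l1fst (s : S) : A := s.1.
Definition l1snd (s : S) : B := s.2.

Lemma bmul0l (E : banachAlgType R) (x : E) : 0 ** x = 0.
Proof. by rewrite -[X in X ** x](scale0r 0) bmulZl scale0r. Qed.

Lemma bmul0r (E : banachAlgType R) (x : E) : x ** 0 = 0.
Proof. by rewrite -[X in x ** X](scale0r 0) bmulZr scale0r. Qed.

Lemma l1inl_hom : bounded_hom l1inl.
Proof.
split; last by move=> x y; congr pair; rewrite bmul0l.
split; first by move=> k x y; congr pair; rewrite /= ?scaler0 ?addr0.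
by exists 1 => x; rewrite mul1r -[leLHS]/(`|x| + `|0|) normr0 addr0.
Qed.

Lemma l1inr_hom : bounded_hom l1inr.
Proof.
split; last by move=> x y; congr pair; rewrite bmul0l.
split; first by move=> k x y; congr pair; rewrite /= ?scaler0 ?addr0.
by exists 1 => x; rewrite mul1r -[leLHS]/(`|0| + `|x|) normr0 add0r.
Qed.

Lemma l1fst_hom : bounded_hom l1fst.
Proof.
do 2?split=> //.
by exists 1 => x; rewrite mul1r -[leRHS]/(`|x.1| + `|x.2|) lerDl.
Qed.

Lemma l1snd_hom : bounded_hom l1snd.
Proof.
do 2?split=> //.
by exists 1 => x; rewrite mul1r -[leRHS]/(`|x.1| + `|x.2|) lerDr.
Qed.

Lemma l1sum_decomp (s : S) : s = l1inl s.1 + l1inr s.2.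
Proof. by case: s => a b; congr pair; rewrite /= ?addr0 ?add0r. Qed.

Lemma l1mul_inlr a b : l1inl a ** l1inr b = 0.
Proof. by congr pair; rewrite /= ?bmul0l ?bmul0r. Qed.

Lemma l1mul_inrl a b : l1inr b ** l1inl a = 0.
Proof. by congr pair; rewrite /= ?bmul0l ?bmul0r. Qed.

(** It is enough to treat [a = x ** y]. By cyclicity the value is then the
    opposite of [D (l1inl (x ** y)) (l1inr b)], which the derivation rule
    expands into values of [D] at products of elements from different
    summands. *)
Lemma cyclic_derivation_cross_eq0 (D : S -> dual S) (a : A) (b : B) :
  closure (@algebra_square R A) = [set: A] ->
  derivation D -> cyclic D -> D (l1inr b) (l1inl a) = 0.
Proof.
move=> dA [bD dD] cD.
suff f0 : pullback l1inl_hom.1 (D (l1inr b)) = 0.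
  by rewrite -[LHS]/(pullback l1inl_hom.1 (D (l1inr b)) a) f0.
apply: (functional_eq0_square dA) => x y /=.
have := cD (l1inr b) (l1inl (x ** y)).
by rewrite l1inl_hom.2 dD /= fctE /= l1mul_inlr l1mul_inrl !dual0 !addr0.
Qed.

Lemma approximately_cyclic_amenable_l1sum :
  commutative_algebra A -> closure (@algebra_square R A) = [set: A] ->
  approximately_cyclic_amenable A -> approximately_cyclic_amenable B ->
  approximately_cyclic_amenable S.
Proof.
move=> cA dA aA aB D dD cD.
have DA0 a : transport l1inl_hom D a = 0.
  apply: commutative_approximately_inner_eq0 => //; apply: aA.
  - exact: transport_derivation.
  - exact: transport_cyclic.
have DBA0 b a := cyclic_derivation_cross_eq0 a b dA dD cD.
have DAB0 a b : D (l1inl a) (l1inr b) = 0.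
  by have := cD (l1inl a) (l1inr b); rewrite DBA0 addr0.
have -> : D = transport l1snd_hom (transport l1inr_hom D).
  apply/funext => s; apply/val_inj/funext => t /=.
  have DA00 : D (l1inl s.1) (l1inl t.1) = 0.
    by rewrite -[LHS]/(transport l1inl_hom D s.1 t.1) DA0.
  rewrite {1}(l1sum_decomp s) (bounded_linearD dD.1) {1}(l1sum_decomp t).
  rewrite /= fctE !(bounded_linearD (dual_bounded_linear _)).
  by rewrite DA00 DAB0 DBA0 !add0r.
apply: transport_approximately_inner; apply: aB.
- exact: transport_derivation.
- exact: transport_cyclic.
Qed.

End DirectSum.

Theorem theorem2p3 (R : realType) (A B : banachAlgType R) :
  (commutative_algebra A -> closure (algebra_square A) = [set: A] ->
   approximately_cyclic_amenable A -> approximately_cyclic_amenable B ->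
   approximately_cyclic_amenable (l1sum A B))
  /\
  (approximately_cyclic_amenable (l1sum A B) ->
   approximately_cyclic_amenable A /\ approximately_cyclic_amenable B).
Proof.
split; first exact: approximately_cyclic_amenable_l1sum.
move=> aS; split.
- by apply: (approximately_cyclic_amenable_retract l1inl_hom l1fst_hom _ aS).
- by apply: (approximately_cyclic_amenable_retract l1inr_hom l1snd_hom _ aS).
Qed.
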